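(* Consider the one-dimensional semi-discrete path-conservative discontinuous Galerkin (PCDG) scheme: find $\boldsymbol v(\cdot,t)\in\boldsymbol{\mathcal V}_h^k$ such that for every cell $\mathcal I_j$ and every $\boldsymbol\varphi\in\boldsymbol{\mathcal V}_h^k$, $\frac{d}{dt}\int_{\mathcal I_j}\boldsymbol v\cdot\boldsymbol\varphi\,dx=\mathrm{RHS}^S_j(\boldsymbol v,b,\boldsymbol\varphi)$; and the two-dimensional semi-discrete PCDG scheme: find $\boldsymbol v(\cdot,\cdot,t)\in\boldsymbol{\mathcal V}_h^k$ such that for every cell $\mathcal I_{ij}$ and every $\boldsymbol\varphi\in\boldsymbol{\mathcal V}_h^k$, $\frac{d}{dt}\iint_{\mathcal I_{ij}}\boldsymbol v\cdot\boldsymbol\varphi\,dx\,dy=\mathrm{RHS}^S_{ij}(\boldsymbol v,b,\boldsymbol\varphi)$ (all operators defined in the context). Both schemes are exact for still water equilibrium states, i.e.: (1D) if $\boldsymbol v=(h_1,m_1,w,m_2)^T$ with $h_1$ and $w$ constant on the whole domain and $m_1=m_2=0$, then $\mathrm{RHS}^S_j(\boldsymbol v,b,\boldsymbol\varphi)=0$ for all $j$ and all $\boldsymbol\varphi\in\boldsymbol{\mathcal V}_h^k$; (2D) if $\boldsymbol v=(h_1,m_1,n_1,w,m_2,n_2)^T$ with $h_1$ and $w$ constant on the whole domain and $m_1=n_1=m_2=n_2=0$, then $\mathrm{RHS}^S_{ij}(\boldsymbol v,b,\boldsymbol\varphi)=0$ for all $i,j$ and all $\boldsymbol\varphi\in\boldsymbol{\mathcal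 V}_h^k$. Consequently such states are stationary solutions of the respective semi-discrete schemes.
   Context: **Constants and unknowns.** $g>0$ is the gravitational acceleration, $0<r<1$ the density ratio. $b$ is a given time-independent bottom topography, smooth in each cell, with one-sided traces at cell interfaces (possibly discontinuous there). $h_1>0$ is the upper-layer depth, $w=h_2+b$ with lower-layer depth $h_2=w-b>0$; $m_i=h_iu_i$ (and in 2D $n_i=h_iv_i$) are discharges, with $u_i$, $v_i$ the velocities of layer $i$ in the $x$- and $y$-directions. Still water equilibrium: $h_1=$ constant, $w=$ constant, zero velocities. **Mesh and spaces.** 1D: the domain is divided into cells $\mathcal I_j=[x_{j-1/2},x_{j+1/2}]$, $j=1,\dots,nx$. 2D: rectangular cells $\mathcal I_{ij}=[x_{i-1/2},x_{i+1/2}]\times[y_{j-1/2},y_{j+1/2}]$. $\mathcal W_h^k$ is the space of functions whose restriction to each cell is a polynomial of degree at most $k$; $\boldsymbol{\mathcal V}_h^k$ is the space of vectors with all $l$ components in $\mathcal W_h^k$ ($l=4$ in 1D, $l=6$ in 2D). Superscripts $-$/$+$ denote the left/right (resp. lower/upper) limits at a cell interface. At the boundary of the domain, exterior traces of $\boldsymbol v$ are supplied by boundary conditions compatible with the equilibrium (e.g. periodic, or free boundary conditions copying the interior state), so for a globally constant $\boldsymbol v$ they equal the same constant. All integrals are exact. **1D scheme.** $\boldsymbol v=(h_1,m_1,w,m_2)^T$, $$\boldsymbol f(\boldsymbol v)=\Big(m_1,\ \tfrac{m_1^2}{h_1}+\tfrac12 gh_1^2,\ m_2,\ \tfrac{m_2^2}{w-b}+\tfrac12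 gw^2\Big)^T,$$ and $\mathcal G(\boldsymbol v)$ is the $4\times4$ matrix whose only nonzero entries are $\mathcal G_{23}=gh_1$, $\mathcal G_{41}=gr(w-b)$, $\mathcal G_{43}=-gb$. Then $$\mathrm{RHS}^S_j=\int_{\mathcal I_j}\boldsymbol f(\boldsymbol v)\cdot\boldsymbol\varphi_x\,dx-\widehat{\boldsymbol f}_{j+\frac12}\cdot\boldsymbol\varphi^-_{j+\frac12}+\widehat{\boldsymbol f}_{j-\frac12}\cdot\boldsymbol\varphi^+_{j-\frac12}-\int_{\mathcal I_j}\mathcal G(\boldsymbol v)\boldsymbol v_x\cdot\boldsymbol\varphi\,dx-\tfrac12\boldsymbol\varphi^-_{j+\frac12}\cdot\boldsymbol{\mathfrak g}_{j+\frac12}-\tfrac12\boldsymbol\varphi^+_{j-\frac12}\cdot\boldsymbol{\mathfrak g}_{j-\frac12},$$ with the Lax–Friedrichs flux $$\widehat{\boldsymbol f}_{j+\frac12}=\tfrac12\big(\boldsymbol f(\boldsymbol v^-_{j+\frac12})+\boldsymbol f(\boldsymbol v^+_{j+\frac12})\big)-\tfrac{\alpha}{2}\big(\boldsymbol v^+_{j+\frac12}-\boldsymbol v^-_{j+\frac12}\big),$$ where each one-sided $\boldsymbol f$ uses the trace of $b$ from the same side and $\alpha$ is the global maximum of the moduli of the eigenvalues of $\partial\boldsymbol f/\partial\boldsymbol v$; and the path integral $$\boldsymbol{\mathfrak g}_{j+\frac12}=\int_0^1\mathcal G(\boldsymbol\phi_{j+\frac12}(\tau))\,\tfrac{\partial}{\partial\tau}\boldsymbol\phi_{j+\frac12}(\tau)\,d\tau,\qquad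 \boldsymbol\phi_{j+\frac12}(\tau)=\boldsymbol v^-_{j+\frac12}+\tau(\boldsymbol v^+_{j+\frac12}-\boldsymbol v^-_{j+\frac12}),$$ where the value of $b$ in $\mathcal G$ along the path is the linear interpolation $b^-+\tau(b^+-b^-)$. **2D scheme.** $\boldsymbol v=(h_1,m_1,n_1,w,m_2,n_2)^T$, $$\boldsymbol f_1=\Big(m_1,\tfrac{m_1^2}{h_1}+\tfrac12gh_1^2,\tfrac{m_1n_1}{h_1},m_2,\tfrac{m_2^2}{w-b}+\tfrac12gw^2,\tfrac{m_2n_2}{w-b}\Big)^T,$$ $$\boldsymbol f_2=\Big(n_1,\tfrac{m_1n_1}{h_1},\tfrac{n_1^2}{h_1}+\tfrac12gh_1^2,n_2,\tfrac{m_2n_2}{w-b},\tfrac{n_2^2}{w-b}+\tfrac12gw^2\Big)^T.$$ $\mathcal G_1$ is the $6\times6$ matrix with only nonzero entries $(2,4)$: $gh_1$; $(5,1)$: $gr(w-b)$; $(5,4)$: $-gb$. $\mathcal G_2$ has only nonzero entries $(3,4)$: $gh_1$; $(6,1)$: $gr(w-b)$; $(6,4)$: $-gb$. Then $$\begin{aligned}\mathrm{RHS}^S_{ij}=&\iint_{\mathcal I_{ij}}\boldsymbol f_1\cdot\boldsymbol\varphi_x\,dxdy-\int_{y_{j-1/2}}^{y_{j+1/2}}\Big(\widehat{\boldsymbol f_1}_{i+\frac12,j}\cdot\boldsymbol\varphi(x^-_{i+\frac12},y)-\widehat{\boldsymbol f_1}_{i-\frac12,j}\cdot\boldsymbol\varphi(x^+_{i-\frac12},y)\Big)dy\\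 &+\iint_{\mathcal I_{ij}}\boldsymbol f_2\cdot\boldsymbol\varphi_y\,dxdy-\int_{x_{i-1/2}}^{x_{i+1/2}}\Big(\widehat{\boldsymbol f_2}_{i,j+\frac12}\cdot\boldsymbol\varphi(x,y^-_{j+\frac12})-\widehat{\boldsymbol f_2}_{i,j-\frac12}\cdot\boldsymbol\varphi(x,y^+_{j-\frac12})\Big)dx\\ &-\iint_{\mathcal I_{ij}}\mathcal G_1\boldsymbol v_x\cdot\boldsymbol\varphi\,dxdy-\int_{y_{j-1/2}}^{y_{j+1/2}}\Big(\tfrac12\boldsymbol\varphi(x^-_{i+\frac12},y)\cdot\boldsymbol{\mathfrak g}_{1,i+\frac12,j}+\tfrac12\boldsymbol\varphi(x^+_{i-\frac12},y)\cdot\boldsymbol{\mathfrak g}_{1,i-\frac12,j}\Big)dy\\ &-\iint_{\mathcal I_{ij}}\mathcal G_2\boldsymbol v_y\cdot\boldsymbol\varphi\,dxdy-\int_{x_{i-1/2}}^{x_{i+1/2}}\Big(\tfrac12\boldsymbol\varphi(x,y^-_{j+\frac12})\cdot\boldsymbol{\mathfrak g}_{2,i,j+\frac12}+\tfrac12\boldsymbol\varphi(x,y^+_{j-\frac12})\cdot\boldsymbol{\mathfrak g}_{2,i,j-\frac12}\Big)dx.\end{aligned}$$ Here $\widehat{\boldsymbol f_1},\widehat{\boldsymbol f_2}$ are the Lax–Friedrichs fluxes at each point of an edge, $\tfrac12(\boldsymbol f_d(\boldsymbol v^-)+\boldsymbol f_d(\boldsymbol v^+))-\tfrac{\alpha_d}2(\boldsymbol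 v^+-\boldsymbol v^-)$, with $\alpha_d$ the global maximum modulus of the eigenvalues of $\partial\boldsymbol f_d/\partial\boldsymbol v$, and $\boldsymbol{\mathfrak g}_{d}=\int_0^1\mathcal G_d(\boldsymbol\phi(\tau))\boldsymbol\phi'(\tau)\,d\tau$ along the segment $\boldsymbol\phi(\tau)=\boldsymbol v^-+\tau(\boldsymbol v^+-\boldsymbol v^-)$ between the two traces at that point of the edge (with $b$ linearly interpolated), $d=1,2$. *)

(* Defs.v *)
From HB Require Import structures.
From mathcomp Require Import all_boot all_order all_algebra.
From mathcomp Require Import complex polyXY.
From mathcomp Require Import all_classical all_reals all_analysis.

Set Implicit Arguments.
Unset Strict Implicit.
Unset Printing Implicit Defensive.

Import Order.TTheory GRing.Theory Num.Theory.
Import numFieldNormedType.Exports.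

Local Open Scope classical_set_scope.
Local Open Scope ring_scope.

Local Notation leb R := (@lebesgue_measure R).

Definition dot (R : realType) n (u v : 'rV[R]_n) : R := \sum_c u 0 c * v 0 c.

(* State vectors are row vectors; [mxact G u] is the column product G u. *)
Definition mxact (R : realType) n (G : 'M[R]_n) (u : 'rV[R]_n) : 'rV[R]_n :=
  u *m G^T.

(* [Ck_on m D f]: f has directional derivatives up to order m, each of order
   < m being Frechet differentiable on D and those of order m continuous. *)
Fixpoint Ck_on (R : realType) (V : normedModType R) (m : nat) (D : set V)
    (f : V -> R) : Prop :=
  match m with
  | 0 => forall x, D x -> {for x, continuous f}
  | m'.+1 => (forall x, D x -> differentiable f x) /\
             (forall u : V, Ck_on m' D (fun x => 'D_u f x))
  end.

Definition smooth_on (R : realType) (V : normedModType R) (D : set V)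
  (f : V -> R) : Prop := forall m, Ck_on m D f.

(* A flux f takes the local bottom value b and the state v; a nonconservative
   matrix G likewise.  b is a parameter, not an unknown: the Jacobian is taken
   in v only. *)

(* moduli of the complex eigenvalues of the Jacobian of [f b] at v; 'J acts on
   row vectors, i.e. is the transpose of the usual Jacobian *)
Definition eig_modulus (R : realType) n (f : R -> 'rV[R]_n -> 'rV[R]_n)
    (b : R) (v : 'rV[R]_n) : set R :=
  [set a | exists2 z : R[i],
     eigenvalue (map_mx (real_complex R) ('J (f b) v)) z & a = ComplexField.Normc.normc z].

Definition lf_flux (R : realType) n (f : R -> 'rV[R]_n -> 'rV[R]_n) (alpha : R)
    (bm : R) (vm : 'rV[R]_n) (bp : R) (vp : 'rV[R]_n) : 'rV[R]_n :=
  2^-1 *: (f bm vm + f bp vp) - (alpha / 2) *: (vp - vm).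

Definition seg (R : realType) (V : lmodType R) (a b : V) (tau : R) : V :=
  a + tau *: (b - a).

Definition path_integral (R : realType) n (G : R -> 'rV[R]_n -> 'M[R]_n)
    (bm : R) (vm : 'rV[R]_n) (bp : R) (vp : 'rV[R]_n) : 'rV[R]_n :=
  \row_c \int[leb R]_(tau in `[0, 1])
    mxact (G (bm + tau * (bp - bm)) (seg vm vp tau))
          (derive1 (seg vm vp) tau) 0 c.

(* Interfaces of a row of n cells are numbered 0, ..., n; interface i lies
   between cells i-1 and i.  F gives the trace coming from each cell, [ext] the
   one supplied by the boundary condition. *)
Definition from_right (T : Type) n (F : 'I_n -> T) (ext : T) (i : nat) : T :=
  oapp F ext (insub i).

Definition from_left (T : Type) n (F : 'I_n -> T) (ext : T) (i : nat) : T :=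
  if i is i'.+1 then oapp F ext (insub i') else ext.

(* Only nodes 0, ..., ncell are meaningful; cell j is [node j, node j.+1]. *)
Record mesh (R : realType) := Mesh {
  ncell : nat;
  node : nat -> R;
  node_lt : forall j, (j < ncell)%N -> node j < node j.+1 }.

Definition cell (R : realType) (M : mesh R) (j : 'I_(ncell M)) : set R :=
  `[node M j, node M j.+1].
Definition open_cell (R : realType) (M : mesh R) (j : 'I_(ncell M)) : set R :=
  `]node M j, node M j.+1[.

(* Piecewise polynomial functions are families of polynomials indexed by the
   cells, so that the one-sided limits at an interface are plain evaluations
   of the polynomial of the cell on the corresponding side. *)

Section OneDimension.
Variables (R : realType) (M : mesh R).
Local Notation nx := (ncell M).
Local Notation x_ := (node M).

Definition dg1 := 'I_nx -> 'rV[{poly R}]_4.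

Definition ev1 (p : 'rV[{poly R}]_4) (x : R) : 'rV[R]_4 :=
  map_mx (fun q : {poly R} => q.[x]) p.
Definition dx1 (p : 'rV[{poly R}]_4) : 'rV[{poly R}]_4 :=
  map_mx (fun q : {poly R} => q^`()) p.

Definition Vh1 (k : nat) (v : dg1) : Prop :=
  forall j c, (size (v j 0%R c) <= k.+1)%N.

Record bottom1 := Bottom1 {
  bot1 :> 'I_nx -> R -> R;
  bot1_smooth : forall j, smooth_on (@open_cell R M j) (bot1 j);
  bot1_trace : forall j, {within cell j, continuous (bot1 j)} }.

Record boundary1 := Boundary1 {
  vleft1 : dg1 -> 'rV[R]_4;
  vright1 : dg1 -> 'rV[R]_4;
  bleft1 : R;
  bright1 : R;
  boundary1_const : forall (v : dg1) (c : 'rV[R]_4),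
    (forall j x, cell j x -> ev1 (v j) x = c) ->
    vleft1 v = c /\ vright1 v = c }.

Definition h1_1 (v : 'rV[R]_4) : R := v 0 0.
Definition m1_1 (v : 'rV[R]_4) : R := v 0 1.
Definition w_1  (v : 'rV[R]_4) : R := v 0 2.
Definition m2_1 (v : 'rV[R]_4) : R := v 0 3.

Definition state1 (h1 m1 w m2 : R) : 'rV[R]_4 :=
  \row_(i < 4) [:: h1; m1; w; m2]`_i.

Variables (g r : R).

Definition f1d (b : R) (v : 'rV[R]_4) : 'rV[R]_4 :=
  let h1 := h1_1 v in let m1 := m1_1 v in
  let w := w_1 v in let m2 := m2_1 v in
  state1 m1
         (m1 ^+ 2 / h1 + 2^-1 * g * h1 ^+ 2)
         m2
         (m2 ^+ 2 / (w - b) + 2^-1 * g * w ^+ 2).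

(* rows and columns are numbered from 0 *)
Definition G1d (b : R) (v : 'rV[R]_4) : 'M[R]_4 :=
  (g * h1_1 v) *: delta_mx 1 2
  + (g * r * (w_1 v - b)) *: delta_mx 3 0
  + (- (g * b)) *: delta_mx 3 2.

Variables (b : bottom1) (B : boundary1).

Definition vm1 (v : dg1) (i : nat) : 'rV[R]_4 :=
  from_left (fun j => ev1 (v j) (x_ i)) (vleft1 B v) i.
Definition vp1 (v : dg1) (i : nat) : 'rV[R]_4 :=
  from_right (fun j => ev1 (v j) (x_ i)) (vright1 B v) i.
Definition bm1 (i : nat) : R := from_left (fun j => b j (x_ i)) (bleft1 B) i.
Definition bp1 (i : nat) : R := from_right (fun j => b j (x_ i)) (bright1 B) i.

(* a maximum for admissible v: the cells are compact and the spectrum depends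
   continuously on the state *)
Definition alpha1 (v : dg1) : R :=
  sup [set a | exists j x, cell j x /\
                 eig_modulus f1d (b j x) (ev1 (v j) x) a].

Definition fhat1 (v : dg1) (i : nat) : 'rV[R]_4 :=
  lf_flux f1d (alpha1 v) (bm1 i) (vm1 v i) (bp1 i) (vp1 v i).

Definition gfrak1 (v : dg1) (i : nat) : 'rV[R]_4 :=
  path_integral G1d (bm1 i) (vm1 v i) (bp1 i) (vp1 v i).

Definition RHS1 (v phi : dg1) (j : 'I_nx) : R :=
  \int[leb R]_(x in cell j)
     dot (f1d (b j x) (ev1 (v j) x)) (ev1 (dx1 (phi j)) x)
  - dot (fhat1 v j.+1) (ev1 (phi j) (x_ j.+1))
  + dot (fhat1 v j) (ev1 (phi j) (x_ j))
  - \int[leb R]_(x in cell j)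
     dot (mxact (G1d (b j x) (ev1 (v j) x)) (ev1 (dx1 (v j)) x))
         (ev1 (phi j) x)
  - 2^-1 * dot (ev1 (phi j) (x_ j.+1)) (gfrak1 v j.+1)
  - 2^-1 * dot (ev1 (phi j) (x_ j)) (gfrak1 v j).

(* h_1 > 0 and h_2 = w - b > 0, boundary states included *)
Definition wet1 (bx : R) (u : 'rV[R]_4) : Prop :=
  0 < h1_1 u /\ 0 < w_1 u - bx.

Definition admissible1 (v : dg1) : Prop :=
  [/\ forall j x, cell j x -> wet1 (b j x) (ev1 (v j) x),
      wet1 (bleft1 B) (vleft1 B v)
    & wet1 (bright1 B) (vright1 B v)].

Definition still_water1 (v : dg1) : Prop :=
  exists h1 w : R, forall j x, cell j x -> ev1 (v j) x = state1 h1 0 w 0.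

Definition pcdg1_solution (k : nat) (v : R -> dg1) : Prop :=
  forall t : R, [/\ Vh1 k (v t), admissible1 (v t)
    & forall (j : 'I_nx) (phi : dg1), Vh1 k phi ->
      is_derive t 1
        (fun s : R => \int[leb R]_(x in cell j)
                        dot (ev1 (v s j) x) (ev1 (phi j) x))
        (RHS1 (v t) phi j)].

End OneDimension.

Section TwoDimensions.
Variables (R : realType) (Mx My : mesh R).
Local Notation nx := (ncell Mx).
Local Notation ny := (ncell My).
Local Notation x_ := (node Mx).
Local Notation y_ := (node My).

(* As in polyXY, a polynomial in (x, y) is a polynomial in x with coefficients
   in {poly R}, the polynomials in y; p.[x, y] is p.[x%:P].[y]. *)
Definition dg2 := 'I_nx -> 'I_ny -> 'rV[{poly {poly R}}]_6.

Definition ev2 (p : 'rV[{poly {poly R}}]_6) (x y : R) : 'rV[R]_6 :=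
  map_mx (fun q : {poly {poly R}} => q.[x, y]) p.
Definition dx2 (p : 'rV[{poly {poly R}}]_6) : 'rV[{poly {poly R}}]_6 :=
  map_mx (fun q : {poly {poly R}} => q^`()) p.
Definition dy2 (p : 'rV[{poly {poly R}}]_6) : 'rV[{poly {poly R}}]_6 :=
  map_mx (fun q : {poly {poly R}} =>
            map_poly (fun c : {poly R} => c^`()) q) p.

(* total degree at most k: the coefficient of x^a y^c vanishes if a + c > k *)
Definition Vh2 (k : nat) (v : dg2) : Prop :=
  forall i j l a c, (k < a + c)%N -> (v i j 0 l)`_a`_c = 0.

Definition cell2 (i : 'I_nx) (j : 'I_ny) : set (R * R) :=
  cell i `*` cell j.

Record bottom2 := Bottom2 {
  bot2 :> 'I_nx -> 'I_ny -> R * R -> R;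
  bot2_smooth : forall i j,
    smooth_on ((open_cell i `*` open_cell j) : set (R * R)%type) (bot2 i j);
  bot2_trace : forall i j, {within cell2 i j, continuous (bot2 i j)} }.

(* exterior traces on the four sides of the domain, as functions of the
   position along the boundary edge of each boundary cell *)
Record boundary2 := Boundary2 {
  vwest : dg2 -> 'I_ny -> R -> 'rV[R]_6;
  veast : dg2 -> 'I_ny -> R -> 'rV[R]_6;
  vsouth : dg2 -> 'I_nx -> R -> 'rV[R]_6;
  vnorth : dg2 -> 'I_nx -> R -> 'rV[R]_6;
  bwest : 'I_ny -> R -> R;
  beast : 'I_ny -> R -> R;
  bsouth : 'I_nx -> R -> R;
  bnorth : 'I_nx -> R -> R;
  boundary2_const : forall (v : dg2) (c : 'rV[R]_6),
    (forall i j x y, cell i x -> cell j y -> ev2 (v i j) x y = c) ->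
    (forall j y, cell j y -> vwest v j y = c /\ veast v j y = c) /\
    (forall i x, cell i x -> vsouth v i x = c /\ vnorth v i x = c) }.

Definition h1_2 (v : 'rV[R]_6) : R := v 0 0.
Definition m1_2 (v : 'rV[R]_6) : R := v 0 1.
Definition n1_2 (v : 'rV[R]_6) : R := v 0 2.
Definition w_2  (v : 'rV[R]_6) : R := v 0 3.
Definition m2_2 (v : 'rV[R]_6) : R := v 0 4.
Definition n2_2 (v : 'rV[R]_6) : R := v 0 5.

Definition state2 (h1 m1 n1 w m2 n2 : R) : 'rV[R]_6 :=
  \row_(i < 6) [:: h1; m1; n1; w; m2; n2]`_i.

Variables (g r : R).

Definition f2d_1 (b : R) (v : 'rV[R]_6) : 'rV[R]_6 :=
  let h1 := h1_2 v in let m1 := m1_2 v in let n1 := n1_2 v in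
  let w := w_2 v in let m2 := m2_2 v in let n2 := n2_2 v in
  state2 m1
         (m1 ^+ 2 / h1 + 2^-1 * g * h1 ^+ 2)
         (m1 * n1 / h1)
         m2
         (m2 ^+ 2 / (w - b) + 2^-1 * g * w ^+ 2)
         (m2 * n2 / (w - b)).

Definition f2d_2 (b : R) (v : 'rV[R]_6) : 'rV[R]_6 :=
  let h1 := h1_2 v in let m1 := m1_2 v in let n1 := n1_2 v in
  let w := w_2 v in let m2 := m2_2 v in let n2 := n2_2 v in
  state2 n1
         (m1 * n1 / h1)
         (n1 ^+ 2 / h1 + 2^-1 * g * h1 ^+ 2)
         n2
         (m2 * n2 / (w - b))
         (n2 ^+ 2 / (w - b) + 2^-1 * g * w ^+ 2).

(* rows and columns are numbered from 0 *)
Definition G2d_1 (b : R) (v : 'rV[R]_6) : 'M[R]_6 :=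
  (g * h1_2 v) *: delta_mx 1 3
  + (g * r * (w_2 v - b)) *: delta_mx 4 0
  + (- (g * b)) *: delta_mx 4 3.

Definition G2d_2 (b : R) (v : 'rV[R]_6) : 'M[R]_6 :=
  (g * h1_2 v) *: delta_mx 2 3
  + (g * r * (w_2 v - b)) *: delta_mx 5 0
  + (- (g * b)) *: delta_mx 5 3.

Variables (b : bottom2) (B : boundary2).

(* Traces at the point (x_i, y) of a vertical edge (m = left, p = right)
   and at the point (x, y_j) of a horizontal edge (m = lower, p = upper). *)
Definition vm2x (v : dg2) (i : nat) (j : 'I_ny) (y : R) : 'rV[R]_6 :=
  from_left (fun l => ev2 (v l j) (x_ i) y) (vwest B v j y) i.
Definition vp2x (v : dg2) (i : nat) (j : 'I_ny) (y : R) : 'rV[R]_6 :=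
  from_right (fun l => ev2 (v l j) (x_ i) y) (veast B v j y) i.
Definition bm2x (i : nat) (j : 'I_ny) (y : R) : R :=
  from_left (fun l => b l j (x_ i, y)) (bwest B j y) i.
Definition bp2x (i : nat) (j : 'I_ny) (y : R) : R :=
  from_right (fun l => b l j (x_ i, y)) (beast B j y) i.

Definition vm2y (v : dg2) (i : 'I_nx) (j : nat) (x : R) : 'rV[R]_6 :=
  from_left (fun l => ev2 (v i l) x (y_ j)) (vsouth B v i x) j.
Definition vp2y (v : dg2) (i : 'I_nx) (j : nat) (x : R) : 'rV[R]_6 :=
  from_right (fun l => ev2 (v i l) x (y_ j)) (vnorth B v i x) j.
Definition bm2y (i : 'I_nx) (j : nat) (x : R) : R :=
  from_left (fun l => b i l (x, y_ j)) (bsouth B i x) j.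
Definition bp2y (i : 'I_nx) (j : nat) (x : R) : R :=
  from_right (fun l => b i l (x, y_ j)) (bnorth B i x) j.

Definition alpha2 (f : R -> 'rV[R]_6 -> 'rV[R]_6) (v : dg2) : R :=
  sup [set a | exists i j x y, [/\ cell i x, cell j y &
                 eig_modulus f (b i j (x, y)) (ev2 (v i j) x y) a]].

Definition fhat2x (v : dg2) (i : nat) (j : 'I_ny) (y : R) : 'rV[R]_6 :=
  lf_flux f2d_1 (alpha2 f2d_1 v)
    (bm2x i j y) (vm2x v i j y) (bp2x i j y) (vp2x v i j y).
Definition fhat2y (v : dg2) (i : 'I_nx) (j : nat) (x : R) : 'rV[R]_6 :=
  lf_flux f2d_2 (alpha2 f2d_2 v)
    (bm2y i j x) (vm2y v i j x) (bp2y i j x) (vp2y v i j x).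

Definition gfrak2x (v : dg2) (i : nat) (j : 'I_ny) (y : R) : 'rV[R]_6 :=
  path_integral G2d_1
    (bm2x i j y) (vm2x v i j y) (bp2x i j y) (vp2x v i j y).
Definition gfrak2y (v : dg2) (i : 'I_nx) (j : nat) (x : R) : 'rV[R]_6 :=
  path_integral G2d_2
    (bm2y i j x) (vm2y v i j x) (bp2y i j x) (vp2y v i j x).

Local Notation leb2 := (leb R \x leb R)%E.

Definition RHS2 (v phi : dg2) (i : 'I_nx) (j : 'I_ny) : R :=
  \int[leb2]_(z in cell2 i j)
     dot (f2d_1 (b i j z) (ev2 (v i j) z.1 z.2)) (ev2 (dx2 (phi i j)) z.1 z.2)
  - \int[leb R]_(y in cell j)
     (dot (fhat2x v i.+1 j y) (ev2 (phi i j) (x_ i.+1) y)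
      - dot (fhat2x v i j y) (ev2 (phi i j) (x_ i) y))
  + \int[leb2]_(z in cell2 i j)
     dot (f2d_2 (b i j z) (ev2 (v i j) z.1 z.2)) (ev2 (dy2 (phi i j)) z.1 z.2)
  - \int[leb R]_(x in cell i)
     (dot (fhat2y v i j.+1 x) (ev2 (phi i j) x (y_ j.+1))
      - dot (fhat2y v i j x) (ev2 (phi i j) x (y_ j)))
  - \int[leb2]_(z in cell2 i j)
     dot (mxact (G2d_1 (b i j z) (ev2 (v i j) z.1 z.2))
                (ev2 (dx2 (v i j)) z.1 z.2))
         (ev2 (phi i j) z.1 z.2)
  - \int[leb R]_(y in cell j)
     (2^-1 * dot (ev2 (phi i j) (x_ i.+1) y) (gfrak2x v i.+1 j y)
      + 2^-1 * dot (ev2 (phi i j) (x_ i) y) (gfrak2x v i j y))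
  - \int[leb2]_(z in cell2 i j)
     dot (mxact (G2d_2 (b i j z) (ev2 (v i j) z.1 z.2))
                (ev2 (dy2 (v i j)) z.1 z.2))
         (ev2 (phi i j) z.1 z.2)
  - \int[leb R]_(x in cell i)
     (2^-1 * dot (ev2 (phi i j) x (y_ j.+1)) (gfrak2y v i j.+1 x)
      + 2^-1 * dot (ev2 (phi i j) x (y_ j)) (gfrak2y v i j x)).

(* h_1 > 0 and h_2 = w - b > 0, boundary states included *)
Definition wet2 (bz : R) (u : 'rV[R]_6) : Prop :=
  0 < h1_2 u /\ 0 < w_2 u - bz.

Definition admissible2 (v : dg2) : Prop :=
  [/\ forall i j x y, cell i x -> cell j y ->
        wet2 (b i j (x, y)) (ev2 (v i j) x y),
      forall j y, cell j y ->
        wet2 (bwest B j y) (vwest B v j y) /\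
        wet2 (beast B j y) (veast B v j y)
    & forall i x, cell i x ->
        wet2 (bsouth B i x) (vsouth B v i x) /\
        wet2 (bnorth B i x) (vnorth B v i x)].

Definition still_water2 (v : dg2) : Prop :=
  exists h1 w : R, forall i j x y, cell i x -> cell j y ->
    ev2 (v i j) x y = state2 h1 0 0 w 0 0.

Definition pcdg2_solution (k : nat) (v : R -> dg2) : Prop :=
  forall t : R, [/\ Vh2 k (v t), admissible2 (v t)
    & forall (i : 'I_nx) (j : 'I_ny) (phi : dg2), Vh2 k phi ->
      is_derive t 1
        (fun s : R => \int[leb2]_(z in cell2 i j)
           dot (ev2 (v s i j) z.1 z.2) (ev2 (phi i j) z.1 z.2))
        (RHS2 (v t) phi i j)].

End TwoDimensions.

(* Main.v *)
Require Import Defs.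
From HB Require Import structures.
From mathcomp Require Import all_boot all_order all_algebra.
From mathcomp Require Import all_classical all_reals all_analysis.
From mathcomp Require Import ring polyXY measurable_realfun.
Import Order.TTheory GRing.Theory Num.Theory.
Import numFieldNormedType.Exports.
Local Open Scope ring_scope.

(** Why still water is preserved exactly.

    The unknowns [h1] and [w = h2 + b] are chosen so that a still water state is
    a single constant vector [u], whatever the bottom is.  Two families of terms
    of the right-hand side then vanish and a third one telescopes.

    - The state has no gradient and no jump.  A polynomial that is constant on
      a cell is a constant polynomial ([polyC_of_constant_on]), so the
      nonconservative volume terms carry a zero factor; and since the two traces
      at every interface are both [u] (the boundary data being compatible with
      constants), the segment joining them is stationary and its path integral
      is zero ([path_integral_const]), even where [b] jumps.

    - The flux sees no bottom.  In the physical flux [b] enters only through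
      quotients with numerator [m2 ^ 2] or [m2 * n2], which vanish at rest
      ([f1d_still], [f2d_1_still], [f2d_2_still]); hence the flux of [u] is one
      constant vector [F] on the whole domain.  The Lax-Friedrichs flux is
      consistent and its viscosity multiplies a zero jump, so every numerical
      flux is [F] as well, independently of the viscosity coefficient
      ([lf_flux_const]).

    - What is left is the integral of [F . phi_x] minus the boundary values of
      [F . phi], that is of a single polynomial [q = F . phi].  In one dimension
      this is zero by the fundamental theorem of calculus
      ([integral_deriv_horner]).  In two dimensions the volume integral of each
      partial derivative is brought to an integral over the edges by Fubini's
      theorem followed by the same one-dimensional identity along each slice
      ([Rintegral2_derivX], [Rintegral2_derivY]).

    Stationarity follows: the time derivative of a constant is zero, and so is
    the right-hand side. *)

Set Implicit Arguments.
Unset Strict Implicit.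
Unset Printing Implicit Defensive.

(** * Polynomials in one variable *)

(** The difference [p - c] would otherwise have more roots in the interval than
    its degree allows. *)
Lemma polyC_of_constant_on (R : realType) (a b c : R) (p : {poly R}) :
  a < b -> (forall x, a <= x <= b -> p.[x] = c) -> p = c%:P.
Proof.
move=> ab pc; apply/eqP; rewrite -subr_eq0; apply/negPn/negP => q0.
set q := p - c%:P in q0.
(* [size q] distinct points of the interval, one more than the degree *)
pose s := [seq a + (b - a) / i.+1%:R | i <- iota 0 (size q)].
have us : uniq s.
  rewrite map_inj_uniq ?iota_uniq// => i j /addrI /mulfI.
  rewrite subr_eq0 gt_eqF// => /(_ isT)/invr_inj/eqP.
  by rewrite eqr_nat => /eqP[].
have rs : all (root q) s.
  apply/allP => _ /mapP[i _ ->].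
  rewrite rootE hornerD hornerN hornerC pc ?subrr//.
  rewrite lerDl divr_ge0 ?subr_ge0 ?(ltW ab)//= -lerBrDl ler_pdivrMr ?ltr0n//.
  by rewrite ler_peMr ?subr_ge0 ?(ltW ab)// ler1n.
by have := max_poly_roots q0 rs us; rewrite size_map size_iota ltnn.
Qed.

Lemma integral_deriv_horner (R : realType) (a b : R) (p : {poly R}) : a < b ->
  (\int[@lebesgue_measure R]_(x in `[a, b]) (p^`().[x])%:E
     = (p.[b] - p.[a])%:E)%E.
Proof.
move=> ab; rewrite (@continuous_FTC2 _ (horner p^`()) (horner p))//.
- by apply: continuous_subspaceT; exact: continuous_horner.
- split; [by move=> x _; exact: derivable_horner| |].
  + by apply: cvg_at_right_filter; exact: continuous_horner.
  + by apply: cvg_at_left_filter; exact: continuous_horner.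
- by move=> x _; rewrite derivE.
Qed.

(** The scalar polynomial obtained by pairing a row of polynomials with a
    constant row: it turns [F . phi] into one polynomial, to which the
    fundamental theorem of calculus applies. *)
Definition contract (S : nzRingType) n (c : 'rV[S]_n) (p : 'rV[{poly S}]_n) :
  {poly S} := \sum_l c 0 l *: p 0 l.

Lemma deriv_contract (S : nzRingType) n (c : 'rV[S]_n) (p : 'rV[{poly S}]_n) :
  (contract c p)^`() = contract c (map_mx (fun q : {poly S} => q^`()) p).
Proof.
by rewrite raddf_sum; apply: eq_bigr => l _; rewrite /= mxE derivZ.
Qed.

Lemma horner_contract (S : nzRingType) n (c : 'rV[S]_n) (p : 'rV[{poly S}]_n)
    (x : S) :
  (contract c p).[x] = \sum_l c 0 l * (p 0 l).[x].
Proof. by rewrite horner_sum; apply: eq_bigr => l _; rewrite hornerZ. Qed.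

(** * Iterated integrals on a product set *)

Section IteratedRintegral.
Local Open Scope classical_set_scope.
Local Open Scope ring_scope.
Context d1 d2 (T1 : measurableType d1) (T2 : measurableType d2) (R : realType).
Variables (m1 : {sigma_finite_measure set T1 -> \bar R}).
Variables (m2 : {sigma_finite_measure set T2 -> \bar R}).
Variables (A : set T1) (B : set T2) (f : T1 * T2 -> R).
Hypotheses (mA : measurable A) (mB : measurable B).
Hypothesis fi : (m1 \x m2)%E.-integrable (A `*` B) (EFin \o f).

Let fi' : (m1 \x m2)%E.-integrable setT (EFin \o (f \_ (A `*` B))).
Proof.
by rewrite -restrict_EFin; exact: (integrable_mkcond _ (measurableX mA mB)).1.
Qed.

(** Extending [f] by zero outside [A `*` B] gives Fubini's theorem on a product
    of sets from the one on the whole space.  The value of the inner integral is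
    asked for as an extended real because a real-valued integral does not
    distinguish an infinite value from zero. *)
Lemma Rintegral_prod21 (F : T2 -> R) :
  (forall y, B y -> \int[m1]_(x in A) (f (x, y))%:E = (F y)%:E)%E ->
  \int[(m1 \x m2)%E]_(z in A `*` B) f z = \int[m2]_(y in B) F y.
Proof.
move=> fF; rewrite Rintegral_mkcond [RHS]Rintegral_mkcond /Rintegral.
rewrite -integral21_prod_meas1//; congr fine; apply: eq_integral => y _.
rewrite /fubini_G /= patchE; case: ifPn => [/set_mem yB|/negP yB].
  rewrite -fF// [RHS]integral_mkcond restrict_EFin.
  apply: eq_integral => x _ /=; congr EFin; rewrite !patchE.
  by congr (if _ then _ else _); apply/idP/idP; rewrite !inE; [case|split].
apply: integral0_eq => x _ /=; rewrite patchE ifN//.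
by apply/negP; rewrite inE => -[_ /= By]; apply: yB; rewrite inE.
Qed.

Lemma Rintegral_prod12 (F : T1 -> R) :
  (forall x, A x -> \int[m2]_(y in B) (f (x, y))%:E = (F x)%:E)%E ->
  \int[(m1 \x m2)%E]_(z in A `*` B) f z = \int[m1]_(x in A) F x.
Proof.
move=> fF; rewrite Rintegral_mkcond [RHS]Rintegral_mkcond /Rintegral.
rewrite -integral12_prod_meas1//; congr fine; apply: eq_integral => x _.
rewrite /fubini_F /= patchE; case: ifPn => [/set_mem xA|/negP xA].
  rewrite -fF// [RHS]integral_mkcond restrict_EFin.
  apply: eq_integral => y _ /=; congr EFin; rewrite !patchE.
  by congr (if _ then _ else _); apply/idP/idP; rewrite !inE; [case|split].
apply: integral0_eq => y _ /=; rewrite patchE ifN//.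
by apply/negP; rewrite inE => -[/= Ax _]; apply: xA; rewrite inE.
Qed.

End IteratedRintegral.

(** * Polynomials in two variables on a rectangle *)

Section Bivariate.
Local Open Scope classical_set_scope.
Local Open Scope ring_scope.
Variable R : realType.
Local Notation leb := (@lebesgue_measure R).
Implicit Types (q : {poly {poly R}}) (a b c d x y : R).

(** Fixing one variable of [q] leaves a polynomial in the other one, and slicing
    commutes with the partial derivative in the remaining variable: this
    reduces statements on two variables to statements on one. *)
Lemma horner2_sliceY q x y : q.[x, y] = (map_poly (horner_eval y) q).[x].
Proof. by rewrite -horner2_swapXY horner_swapXY. Qed.

Lemma deriv_sliceY q y :
  (map_poly (horner_eval y) q)^`() = map_poly (horner_eval y) q^`().
Proof. exact: deriv_map. Qed.

Lemma deriv_sliceX q x :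
  (q.[x%:P])^`() = (map_poly (fun p : {poly R} => p^`()) q).[x%:P].
Proof.
rewrite (horner_coef_wide _ (size_poly _ _ : size (map_poly _ _) <= _)%N).
rewrite horner_coef raddf_sum/=.
apply: eq_bigr => i _; rewrite coef_map_id0 ?deriv0// derivM.
by rewrite -polyC_exp derivC mulr0 addr0.
Qed.

Lemma continuous_horner2 q : continuous (fun z : R * R => q.[z.1, z.2]).
Proof.
move=> z; elim/poly_ind: q => [|q p IH].
  under eq_fun do rewrite !hornerE.
  exact: cvg_cst.
under eq_fun do rewrite !hornerE.
apply: cvgD; first by apply: cvgM => //; exact: cvg_fst.
apply: (@continuous_comp _ _ _ snd (horner p)); first exact: cvg_snd.
exact: continuous_horner.
Qed.

Lemma measurable_horner2 q :
  measurable_fun [set: R * R] (fun z : R * R => q.[z.1, z.2]).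
Proof.
elim/poly_ind: q => [|q p IH].
  under eq_fun do rewrite !hornerE.
  exact: measurable_cst.
under eq_fun do rewrite !hornerE.
apply: measurable_funD; first by apply: measurable_funM.
apply: (measurableT_comp (f := horner p)) => //.
by apply: continuous_measurable_fun; exact: continuous_horner.
Qed.

Lemma integrable_horner2 q a b c d :
  (leb \x leb)%E.-integrable (`[a, b] `*` `[c, d])
    (EFin \o (fun z : R * R => q.[z.1, z.2])).
Proof.
apply: measurable_bounded_integrable.
- exact: measurableX.
- rewrite [X in (X < _)%E]product_measure1E//= !lebesgue_measure_itv/=.
  by case: ifP => _; case: ifP => _; rewrite ?mul0e ?mule0 ?ltry.
- by apply: measurable_funTS; exact: measurable_horner2.
- have /compact_bounded : compact
     ((fun z : R * R => q.[z.1, z.2]) @` (`[a, b] `*` `[c, d])).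
    apply: continuous_compact.
      by apply: continuous_subspaceT; exact: continuous_horner2.
    by apply: compact_setX; exact: segment_compact.
  case=> M [Mr MB]; exists M; split => // N MN z Dz /=.
  by apply: (MB N MN); exists z.
Qed.

(** The divergence theorem on a rectangle for each coordinate direction: the
    fundamental theorem of calculus on every slice, then integration over the
    slices. *)
Lemma Rintegral2_derivX q a b c d : a < b ->
  \int[(leb \x leb)%E]_(z in `[a, b] `*` `[c, d]) (q^`()).[z.1, z.2] =
  \int[leb]_(y in `[c, d]) (q.[b, y] - q.[a, y]).
Proof.
move=> ab; apply: Rintegral_prod21 => //; first exact: integrable_horner2.
move=> y _ /=; rewrite !horner2_sliceY -integral_deriv_horner//.
by apply: eq_integral => x _; rewrite horner2_sliceY deriv_sliceY.
Qed.

Lemma Rintegral2_derivY q a b c d : c < d ->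
  \int[(leb \x leb)%E]_(z in `[a, b] `*` `[c, d]) (q.[z.1%:P])^`().[z.2] =
  \int[leb]_(x in `[a, b]) (q.[x, d] - q.[x, c]).
Proof.
move=> cd; apply: Rintegral_prod12 => //; last first.
  by move=> x _ /=; rewrite -integral_deriv_horner.
have -> : (fun z : R * R => (q.[z.1%:P])^`().[z.2]) =
    (fun z => (map_poly (fun p : {poly R} => p^`()) q).[z.1, z.2]).
  by apply/funext => z; rewrite deriv_sliceX.
exact: integrable_horner2.
Qed.

End Bivariate.

(** * Numerical fluxes and path integrals at a constant state *)

Section ConstantState.
Local Open Scope classical_set_scope.
Local Open Scope ring_scope.
Variable R : realType.

Lemma dotv0 n (u : 'rV[R]_n) : dot u 0 = 0.
Proof. by rewrite /dot big1// => i _; rewrite mxE mulr0. Qed.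

Lemma dot0v n (u : 'rV[R]_n) : dot 0 u = 0.
Proof. by rewrite /dot big1// => i _; rewrite mxE mul0r. Qed.

Lemma mxactv0 n (G : 'M[R]_n) : mxact G 0 = 0.
Proof. exact: mul0mx. Qed.

(** Consistency.  The bottom may jump across the interface: only the value of
    the flux at the common state has to be independent of it. *)
Lemma lf_flux_const n (f : R -> 'rV[R]_n -> 'rV[R]_n) alpha bm bp u F :
  (forall b, f b u = F) -> lf_flux f alpha bm u bp u = F.
Proof.
move=> fu; rewrite /lf_flux !fu subrr scaler0 subr0.
by rewrite scalerDr -scalerDl -[2^-1]mul1r -splitr scale1r.
Qed.

Lemma path_integral_const n (G : R -> 'rV[R]_n -> 'M[R]_n) bm bp u :
  path_integral G bm u bp u = 0.
Proof.
apply/rowP => c; rewrite !mxE /Rintegral integral0_eq// => tau _.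
have -> : seg u u = cst u.
  by apply/funext => t; rewrite /seg subrr scaler0 addr0.
by rewrite derive1_cst mxactv0 mxE.
Qed.

Lemma from_left_const (T : Type) n (F : 'I_n -> T) ext i (u : T) :
  ext = u -> (forall l : 'I_n, l.+1 = i -> F l = u) -> from_left F ext i = u.
Proof.
move=> eu Fu; case: i Fu => [|i] //= Fu.
by case: insubP => //= l _ /(congr1 succn)/Fu.
Qed.

Lemma from_right_const (T : Type) n (F : 'I_n -> T) ext i (u : T) :
  ext = u -> (forall l : 'I_n, l = i :> nat -> F l = u) ->
  from_right F ext i = u.
Proof. by move=> eu Fu; rewrite /from_right; case: insubP => //= l _ /Fu. Qed.

Lemma cell_left (M : mesh R) (j : 'I_(ncell M)) : cell j (node M j).
Proof. by rewrite /cell /= in_itv/= lexx ltW// node_lt. Qed.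

Lemma cell_right (M : mesh R) (j : 'I_(ncell M)) : cell j (node M j.+1).
Proof. by rewrite /cell /= in_itv/= lexx ltW// node_lt. Qed.

End ConstantState.

(** * The scheme in one dimension *)

Section OneDimension.
Local Open Scope classical_set_scope.
Local Open Scope ring_scope.
Variables (R : realType) (M : mesh R) (g r : R).
Variables (b : bottom1 M) (B : boundary1 M) (v : dg1 M) (u : 'rV[R]_4).
Hypothesis vu : forall j x, cell j x -> ev1 (v j) x = u.
Local Notation leb := (@lebesgue_measure R).

Lemma trace1_const i : vm1 B v i = u /\ vp1 B v i = u.
Proof.
have [vl vr] := boundary1_const B vu; split.
- by apply: from_left_const => // l <-; exact/vu/cell_right.
- by apply: from_right_const => // l <-; exact/vu/cell_left.
Qed.

Lemma ev1_dx1_const j x : ev1 (dx1 (v j)) x = 0.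
Proof.
apply/rowP => l; rewrite !mxE.
rewrite (@polyC_of_constant_on _ (node M j) (node M j.+1) (u 0 l) (v j 0 l)).
- by rewrite derivC horner0.
- exact: node_lt.
- by move=> y yj; rewrite -(@vu j y)// mxE.
Qed.

Lemma dot_ev1 (F : 'rV[R]_4) p x : dot F (ev1 p x) = (contract F p).[x].
Proof. by rewrite horner_contract; apply: eq_bigr => l _; rewrite mxE. Qed.

Lemma gfrak1_const i : gfrak1 g r b B v i = 0.
Proof.
rewrite /gfrak1; have [-> ->] := trace1_const i.
exact: path_integral_const.
Qed.

Variable F : 'rV[R]_4.
Hypothesis fu : forall bx, f1d g bx u = F.

Lemma fhat1_const i : fhat1 g b B v i = F.
Proof.
rewrite /fhat1; have [-> ->] := trace1_const i.
exact: lf_flux_const.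
Qed.

Lemma volume_flux1 (phi : dg1 M) j :
  \int[leb]_(x in cell j)
     dot (f1d g (b j x) (ev1 (v j) x)) (ev1 (dx1 (phi j)) x) =
  dot F (ev1 (phi j) (node M j.+1)) - dot F (ev1 (phi j) (node M j)).
Proof.
rewrite !dot_ev1 /Rintegral -[RHS]/(fine (_)%:E).
rewrite -integral_deriv_horner ?node_lt//; congr fine.
apply: eq_integral => x /set_mem xj.
by rewrite vu// fu deriv_contract dot_ev1.
Qed.

Lemma RHS1_const (phi : dg1 M) j : RHS1 g r b B v phi j = 0.
Proof.
rewrite /RHS1 volume_flux1 !fhat1_const !gfrak1_const !dotv0 mulr0 !subr0.
rewrite [X in _ - X](_ : _ = 0); last first.
  rewrite /Rintegral integral0_eq// => x _.
  by rewrite ev1_dx1_const mxactv0 dot0v.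
by ring.
Qed.

End OneDimension.

(** * The scheme in two dimensions *)

Section TwoDimensions.
Local Open Scope classical_set_scope.
Local Open Scope ring_scope.
Variables (R : realType) (Mx My : mesh R) (g r : R).
Variables (b : bottom2 Mx My) (B : boundary2 Mx My) (v : dg2 Mx My).
Variable u : 'rV[R]_6.
Hypothesis vu : forall i j x y, cell i x -> cell j y -> ev2 (v i j) x y = u.
Local Notation leb := (@lebesgue_measure R).
Local Notation leb2 := (leb \x leb)%E.

Lemma trace2x_const i (j : 'I_(ncell My)) y : cell j y ->
  vm2x B v i j y = u /\ vp2x B v i j y = u.
Proof.
move=> yj; have [/(_ j y yj)[vl vr] _] := boundary2_const B vu; split.
- by apply: from_left_const => // l <-; apply: vu => //; exact: cell_right.
- by apply: from_right_const => // l <-; apply: vu => //; exact: cell_left.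
Qed.

Lemma trace2y_const (i : 'I_(ncell Mx)) j x : cell i x ->
  vm2y B v i j x = u /\ vp2y B v i j x = u.
Proof.
move=> xi; have [_ /(_ i x xi)[vl vr]] := boundary2_const B vu; split.
- by apply: from_left_const => // l <-; apply: vu => //; exact: cell_right.
- by apply: from_right_const => // l <-; apply: vu => //; exact: cell_left.
Qed.

Lemma ev2_dx2_const i j x y : cell j y -> ev2 (dx2 (v i j)) x y = 0.
Proof.
move=> yj; apply/rowP => l; rewrite !mxE horner2_sliceY -deriv_sliceY.
rewrite (@polyC_of_constant_on _ (node Mx i) (node Mx i.+1) (u 0 l)
           (map_poly _ _)).
- by rewrite derivC horner0.
- exact: node_lt.
- by move=> t ti; rewrite -(@vu i j t y)// mxE horner2_sliceY.
Qed.

Lemma ev2_dy2_const i j x y : cell i x -> ev2 (dy2 (v i j)) x y = 0.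
Proof.
move=> xi; apply/rowP => l; rewrite !mxE -deriv_sliceX.
rewrite (@polyC_of_constant_on _ (node My j) (node My j.+1) (u 0 l) _.[_]).
- by rewrite derivC horner0.
- exact: node_lt.
- by move=> t tj; rewrite -(@vu i j x t)// mxE.
Qed.

Local Notation contract2 F p := (contract (map_mx polyC F) p).

Lemma dot_ev2 (F : 'rV[R]_6) p x y :
  dot F (ev2 p x y) = (contract2 F p).[x, y].
Proof.
rewrite horner_contract horner_sum; apply: eq_bigr => l _.
by rewrite !mxE hornerM hornerC.
Qed.

Lemma dot_ev2_dy2 (F : 'rV[R]_6) p x y :
  dot F (ev2 (dy2 p) x y) = ((contract2 F p).[x%:P])^`().[y].
Proof.
rewrite horner_contract raddf_sum horner_sum; apply: eq_bigr => l _.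
by rewrite !mxE -deriv_sliceX /= mul_polyC derivZ hornerZ.
Qed.

Lemma gfrak2x_const i (j : 'I_(ncell My)) y : cell j y ->
  gfrak2x g r b B v i j y = 0.
Proof.
move=> yj; rewrite /gfrak2x; have [-> ->] := trace2x_const i yj.
exact: path_integral_const.
Qed.

Lemma gfrak2y_const (i : 'I_(ncell Mx)) j x : cell i x ->
  gfrak2y g r b B v i j x = 0.
Proof.
move=> xi; rewrite /gfrak2y; have [-> ->] := trace2y_const j xi.
exact: path_integral_const.
Qed.

Variables F1 F2 : 'rV[R]_6.
Hypothesis fu1 : forall bz, f2d_1 g bz u = F1.
Hypothesis fu2 : forall bz, f2d_2 g bz u = F2.

Lemma fhat2x_const i (j : 'I_(ncell My)) y : cell j y ->
  fhat2x g b B v i j y = F1.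
Proof.
move=> yj; rewrite /fhat2x; have [-> ->] := trace2x_const i yj.
exact: lf_flux_const.
Qed.

Lemma fhat2y_const (i : 'I_(ncell Mx)) j x : cell i x ->
  fhat2y g b B v i j x = F2.
Proof.
move=> xi; rewrite /fhat2y; have [-> ->] := trace2y_const j xi.
exact: lf_flux_const.
Qed.

(** The volume terms are written with the numerical fluxes on the right so that
    they cancel syntactically against the edge terms of the scheme. *)
Lemma volume_flux2x (phi : dg2 Mx My) i j :
  \int[leb2]_(z in cell2 i j)
     dot (f2d_1 g (b i j z) (ev2 (v i j) z.1 z.2))
         (ev2 (dx2 (phi i j)) z.1 z.2) =
  \int[leb]_(y in cell j)
     (dot (fhat2x g b B v i.+1 j y) (ev2 (phi i j) (node Mx i.+1) y)
      - dot (fhat2x g b B v i j y) (ev2 (phi i j) (node Mx i) y)).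
Proof.
transitivity (\int[leb2]_(z in cell2 i j)
                ((contract2 F1 (phi i j))^`()).[z.1, z.2]).
  apply: eq_Rintegral => z /set_mem[zi zj].
  by rewrite vu// fu1 dot_ev2 deriv_contract.
rewrite Rintegral2_derivX ?node_lt//.
apply: eq_Rintegral => y /set_mem yj.
by rewrite !fhat2x_const// !dot_ev2.
Qed.

Lemma volume_flux2y (phi : dg2 Mx My) i j :
  \int[leb2]_(z in cell2 i j)
     dot (f2d_2 g (b i j z) (ev2 (v i j) z.1 z.2))
         (ev2 (dy2 (phi i j)) z.1 z.2) =
  \int[leb]_(x in cell i)
     (dot (fhat2y g b B v i j.+1 x) (ev2 (phi i j) x (node My j.+1))
      - dot (fhat2y g b B v i j x) (ev2 (phi i j) x (node My j))).
Proof.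
transitivity (\int[leb2]_(z in cell2 i j)
                ((contract2 F2 (phi i j)).[z.1%:P])^`().[z.2]).
  apply: eq_Rintegral => z /set_mem[zi zj].
  by rewrite vu// fu2 dot_ev2_dy2.
rewrite Rintegral2_derivY ?node_lt//.
apply: eq_Rintegral => x /set_mem xi.
by rewrite !fhat2y_const// !dot_ev2.
Qed.

Lemma RHS2_const (phi : dg2 Mx My) i j : RHS2 g r b B v phi i j = 0.
Proof.
rewrite /RHS2 volume_flux2x volume_flux2y subrr add0r subrr sub0r.
(* the remaining four integrals, last one first, have a zero integrand *)
rewrite [X in _ - X](_ : _ = 0); last first.
  rewrite /Rintegral integral0_eq// => x xi.
  by rewrite !gfrak2y_const// !dotv0 mulr0 addr0.
rewrite [X in _ - X - 0](_ : _ = 0); last first.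
  rewrite /Rintegral integral0_eq// => z [zi _].
  by rewrite ev2_dy2_const// mxactv0 dot0v.
rewrite [X in _ - X - 0 - 0](_ : _ = 0); last first.
  rewrite /Rintegral integral0_eq// => y yj.
  by rewrite !gfrak2x_const// !dotv0 mulr0 addr0.
rewrite [X in - X - 0 - 0 - 0](_ : _ = 0); last first.
  rewrite /Rintegral integral0_eq// => z [_ zj].
  by rewrite ev2_dx2_const// mxactv0 dot0v.
by rewrite !subr0 oppr0.
Qed.

End TwoDimensions.

(** * Still water *)

Lemma f1d_still (R : realType) (g bx h1 w : R) :
  f1d g bx (state1 h1 0 w 0) =
  state1 0 (2^-1 * g * h1 ^+ 2) 0 (2^-1 * g * w ^+ 2).
Proof.
rewrite /f1d /h1_1 /m1_1 /w_1 /m2_1 !mxE /=.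
by rewrite expr0n/= !mul0r !add0r.
Qed.

Lemma f2d_1_still (R : realType) (g bz h1 w : R) :
  f2d_1 g bz (state2 h1 0 0 w 0 0) =
  state2 0 (2^-1 * g * h1 ^+ 2) 0 0 (2^-1 * g * w ^+ 2) 0.
Proof.
rewrite /f2d_1 /h1_2 /m1_2 /n1_2 /w_2 /m2_2 /n2_2 !mxE /=.
by rewrite expr0n/= !mul0r !add0r.
Qed.

Lemma f2d_2_still (R : realType) (g bz h1 w : R) :
  f2d_2 g bz (state2 h1 0 0 w 0 0) =
  state2 0 0 (2^-1 * g * h1 ^+ 2) 0 0 (2^-1 * g * w ^+ 2).
Proof.
rewrite /f2d_2 /h1_2 /m1_2 /n1_2 /w_2 /m2_2 /n2_2 !mxE /=.
by rewrite expr0n/= !mul0r !add0r.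
Qed.

Theorem theorem3p1 (R : realType) (g r : R) (g_gt0 : 0 < g)
    (r_gt0 : 0 < r) (r_lt1 : r < 1) (k : nat) :
  (forall (M : mesh R) (b : bottom1 M) (B : boundary1 M) (v : dg1 M),
     Vh1 k v -> admissible1 b B v -> still_water1 v ->
     (forall (j : 'I_(ncell M)) (phi : dg1 M),
        Vh1 k phi -> RHS1 g r b B v phi j = 0) /\
     pcdg1_solution g r b B k (fun _ : R => v)) /\
  (forall (Mx My : mesh R) (b : bottom2 Mx My) (B : boundary2 Mx My)
          (v : dg2 Mx My),
     Vh2 k v -> admissible2 b B v -> still_water2 v ->
     (forall (i : 'I_(ncell Mx)) (j : 'I_(ncell My)) (phi : dg2 Mx My),
        Vh2 k phi -> RHS2 g r b B v phi i j = 0) /\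
     pcdg2_solution g r b B k (fun _ : R => v)).
Proof.
split=> [M b B v vk va [h1 [w vu]]|Mx My b B v vk va [h1 [w vu]]].
- have rhs0 j phi : RHS1 g r b B v phi j = 0.
    by apply: (RHS1_const _ _ _ vu) => bx; exact: f1d_still.
  by split=> // t; split=> // j phi _; rewrite rhs0; exact: is_derive_cst.
- have rhs0 i j phi : RHS2 g r b B v phi i j = 0.
    apply: (RHS2_const _ _ _ vu) => bz; [exact: f2d_1_still|].
    exact: f2d_2_still.
  by split=> // t; split=> // i j phi _; rewrite rhs0; exact: is_derive_cst.
Qed.
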